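(* For each integer $n\ge 2$, let $T_1,T_2$ be two independent spanning trees of the complete graph $K_n$ on vertex set $[n]$, each chosen uniformly at random, and let $X_n$ be the number of edges common to $T_1$ and $T_2$. Then $X_n$ converges in distribution to a Poisson distribution with expected value $2$ as $n\to\infty$; in particular, for every integer $m\ge 0$, $\mathbb{P}(X_n=m)\to \frac{2^m}{e^2 m!}$. *)

(* Defs.v *)
From HB Require Import structures.
From mathcomp Require Import all_boot all_order all_algebra.
From mathcomp Require Import all_classical all_reals all_analysis.

Set Implicit Arguments.
Unset Strict Implicit.
Unset Printing Implicit Defensive.

Import Order.TTheory GRing.Theory Num.Theory.
Import numFieldNormedType.Exports.

(* A graph with vertex set V is given by its set of edges, an edge being the
   set of its two endpoints. *)
Definition edge_set (V : finType) : Type := {set {set V}}.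

HB.instance Definition _ (V : finType) := 
  Finite.copy (edge_set V) {set {set V}}.
HB.instance Definition _ (V : finType) := 
  isPointed.Build (edge_set V) (@finset.set0 {set V}).

HB.instance Definition _ (V : finType) :=
  @isMeasurable.Build default_measure_display (edge_set V)
    discrete_measurable discrete_measurable0
    discrete_measurableC discrete_measurableU.

Section graphs.
Local Open Scope set_scope.
Variable V : finType.
Implicit Type E G : {set {set V}}.

Definition complete_graph : {set {set V}} := [set e : {set V} | #|e| == 2].

Definition adjacency E : rel V := [rel x y | [set x; y] \in E].

Definition connected_graph E : bool :=
  [forall x, forall y, connect (adjacency E) x y].

(* The bound on the size excludes the empty cycle, loops, and the walk that
   goes back and forth along a single edge. *)
Definition acyclic_graph E : bool :=
  `[< forall c : seq V, ucycle (adjacency E) c -> (size c <= 2)%N >].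

Definition spanning_trees G : {set {set {set V}}} :=
  [set E : {set {set V}} |
    [&& E \subset G, connected_graph E & acyclic_graph E]].

End graphs.

Local Open Scope classical_set_scope.
Local Open Scope ring_scope.

Section random_elements.
Context d (T : measurableType d) (R : realType) (P : probability T R).
Local Open Scope ereal_scope.

Definition uniform_on (V : finType) (S : {set {set {set V}}})
    (X : {RV P >-> edge_set V}) : Prop :=
  forall E : edge_set V, P (X @^-1` [set E]) =
    (if E \in S then (#|S|%:R^-1)%R else 0%R)%:E.

Definition independent_RV d1 d2 (T1 : measurableType d1)
    (T2 : measurableType d2) (X : {RV P >-> T1}) (Y : {RV P >-> T2}) : Prop :=
  forall (A : set T1) (B : set T2), measurable A -> measurable B ->
    P (X @^-1` A `&` Y @^-1` B) = P (X @^-1` A) * P (Y @^-1` B).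

End random_elements.

Section common_edges.
Context d (T : measurableType d) (R : realType) (P : probability T R).
Variables (V : finType) (X Y : {RV P >-> edge_set V}).

Definition common_edges (w : T) : R := #|(X w :&: Y w)%SET|%:R.

Let measurable_common_edges : measurable_fun [set: T] common_edges.
Proof.
move=> _ A mA; rewrite setTI.
rewrite (_ : _ @^-1` A = \bigcup_(E in [set: edge_set V])
    \bigcup_(F in [set F : edge_set V | A #|(E :&: F)%SET|%:R])
      (X @^-1` [set E] `&` Y @^-1` [set F])); last first.
  apply/seteqP; split=> [w /= Aw|w [E _] [F /= AEF] [/= XE YF]].
    by exists (X w) => //; exists (Y w).
  by rewrite /= /common_edges XE YF.
apply: fin_bigcup_measurable => // E _.
apply: fin_bigcup_measurable => // F _.
by apply: measurableI; exact: measurable_funPTI.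
Qed.

HB.instance Definition _ := @isMeasurableFun.Build _ _ _ _ common_edges
  measurable_common_edges.

End common_edges.

Definition natRV (R : realType) (k : nat) : R := k%:R.

HB.instance Definition _ (R : realType) :=
  @isMeasurableFun.Build _ _ nat R (@natRV R) (fun _ _ _ => I).

(* The nat argument of poisson_prob is a dummy: the body of its definition
   rebinds it. *)
Definition poisson_RV (R : realType) (rate : R) :
  {RV (poisson_prob rate 0%N : probability nat R) >-> R} := @natRV R.

(* cdf takes values in \bar R; being finite, its continuity at x there is
   continuity as a real function. *)
Definition cvg_in_distribution (R : realType)
    (d : nat -> measure_display) (T : forall n, measurableType (d n))
    (P : forall n, probability (T n) R) (X : forall n, {RV (P n) >-> R})
    (d' : measure_display) (T' : measurableType d')
    (Q : probability T' R) (Y : {RV Q >-> R}) : Prop :=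
  forall x : R, {for x, continuous (cdf Y)} ->
    cdf (X n) x @[n --> \oo] --> cdf Y x.

(* Main.v *)
(* Merging two components of sizes a and b multiplies the product w(F) of the
   component sizes of a forest F by 1/a + 1/b, and for a forest with c components
   on n vertices the sum of 1/a + 1/b over ordered pairs of vertices in
   distinct components is 2 n (c - 1).  Hence, by induction on c, exactly
   n^(c-2) w(F) spanning trees contain F.  So the k-th binomial moment of the
   overlap is n^(-2k) times the sum of w(F)^2 over forests with k edges.  Adding
   one edge, with 4 ((1/a + 1/b) - 1) <= (1/a + 1/b)^2 <= 4, shows that this
   moment lies between (2^k / k!) (1 - k (k + 1) / n) and 2^k / k!, and binomial
   inversion then gives the law of the overlap up to O(1/n). *)

Require Import Defs.
From HB Require Import structures.
From mathcomp Require Import all_boot all_order all_algebra.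
From mathcomp Require Import all_classical all_reals all_analysis.
From mathcomp Require Import zify ring lra.

Import Order.TTheory GRing.Theory Num.Theory.
Import numFieldNormedType.Exports.
Local Open Scope classical_set_scope.
Local Open Scope ring_scope.

(** * Connected components of an edge set, and how one new edge changes them *)

Section Components.
#[local] Set Implicit Arguments.
#[local] Unset Strict Implicit.
Local Open Scope nat_scope.
Local Open Scope set_scope.
Variable V : finType.
Implicit Types (E F G : {set {set V}}) (e : {set V}) (x y u v : V).

Definition component E x := [set y | connect (adjacency E) x y].
Definition components E := [set component E x | x in V].

Lemma adjacencyC E : symmetric (adjacency E).
Proof. by move=> x y; rewrite /adjacency /= finset.setUC. Qed.

Lemma connect_adjC E : connect_sym (adjacency E).
Proof. exact/sym_connect_sym/adjacencyC. Qed.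

Lemma componentP E x y : (y \in component E x) = connect (adjacency E) x y.
Proof. by rewrite inE. Qed.

Lemma component_id E x : x \in component E x.
Proof. by rewrite componentP connect0. Qed.

Lemma component_eq E x y :
  (component E x == component E y) = connect (adjacency E) x y.
Proof.
apply/eqP/idP => [exy|cxy]; first by rewrite -componentP exy component_id.
by apply/setP => z; rewrite !componentP (same_connect (connect_adjC E) cxy).
Qed.

Lemma component_transfer E x y :
  y \in component E x -> component E y = component E x.
Proof. by rewrite componentP -component_eq => /eqP. Qed.

Lemma set2_eq x y u v : [set u; v] = [set x; y] ->
  (u = x /\ v = y) \/ (u = y /\ v = x).
Proof.
move=> e.
have hu : u \in [set x; y] by rewrite -e set21.
have hv : v \in [set x; y] by rewrite -e set22.
have hx : x \in [set u; v] by rewrite e set21.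
have hy : y \in [set u; v] by rewrite e set22.
move: hu hv hx hy; rewrite !inE.
case/orP=> /eqP -> /orP[] /eqP -> /orP[] /eqP h1 /orP[] /eqP h2; subst; auto.
Qed.

Lemma connect_sub_adj E F u v : E \subset F ->
  connect (adjacency E) u v -> connect (adjacency F) u v.
Proof.
move=> EF; apply: connect_sub => a b /= ab; apply: connect1 => /=.
exact: (fintype.subsetP EF).
Qed.

Lemma connect_edge E x y : [set x; y] \in E -> connect (adjacency E) x y.
Proof. by move=> h; apply: connect1. Qed.

(** Induction on the path: crossing the new edge again only leads back to one of its endpoints, so a
    single crossing is enough. *)
Lemma connect_setU1 E x y u v :
  connect (adjacency ([set x; y] |: E)) u v =
  [|| connect (adjacency E) u v,
      connect (adjacency E) u x && connect (adjacency E) y v |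
      connect (adjacency E) u y && connect (adjacency E) x v].
Proof.
apply/idP/idP => [/connectP[p]|].
  elim: p u => [|w p IHp] u /= => [_ ->|]; first by rewrite connect0.
  case/andP => uw pw /(IHp _ pw) {IHp pw}; move: uw.
  case/setU1P => [/set2_eq[] [-> ->]|/connect_edge uw].
  - by case/or3P => [|/andP[_]|/andP[_]] ->; rewrite ?connect0 ?orbT.
  - by case/or3P => [|/andP[_]|/andP[_]] ->; rewrite ?connect0 ?orbT.
  - by rewrite !(same_connect (connect_adjC E) uw).
have sE : E \subset [set x; y] |: E by exact: finset.subsetUr.
have xy : connect (adjacency ([set x; y] |: E)) x y.
  by apply: connect_edge; rewrite setU11.
case/or3P => [|/andP[ux yv]|/andP[uy xv]]; first exact: connect_sub_adj.
  apply: connect_trans (connect_sub_adj sE ux) _.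
  exact: connect_trans xy (connect_sub_adj sE yv).
apply: connect_trans (connect_sub_adj sE uy) _.
rewrite connect_adjC in xy.
exact: connect_trans xy (connect_sub_adj sE xv).
Qed.

Lemma component_setU1_connect E x y u : connect (adjacency E) x y ->
  component ([set x; y] |: E) u = component E u.
Proof.
move=> xy; apply/setP => v; rewrite !componentP connect_setU1.
apply/or3P/idP => [[//|/andP[ux yv]|/andP[uy xv]]|]; last by constructor 1.
  exact: connect_trans ux (connect_trans xy yv).
rewrite connect_adjC in xy.
exact: connect_trans uy (connect_trans xy xv).
Qed.

Lemma component_setU1 E x y u :
  component ([set x; y] |: E) u =
  if u \in component E x :|: component E y then component E x :|: component E y
  else component E u.
Proof.
apply/setP => v; rewrite componentP connect_setU1 finset.in_setU !componentP.
rewrite (connect_adjC E u x) (connect_adjC E u y).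
case: ifP => [/orP[ux|uy]|/norP[/negbTE -> /negbTE ->]]; last first.
- by rewrite !componentP !orbF.
- rewrite finset.in_setU !componentP uy -(same_connect (connect_adjC E) uy) /=.
  by do !case: (connect _ _ _).
- rewrite finset.in_setU !componentP ux -(same_connect (connect_adjC E) ux) /=.
  by do !case: (connect _ _ _).
Qed.

Lemma components_setU1_connect E x y : connect (adjacency E) x y ->
  components ([set x; y] |: E) = components E.
Proof. by move=> xy; apply: eq_imset => u; rewrite component_setU1_connect. Qed.

(** This covers connected [x] and [y] too: the two deleted blocks then coincide, and the union puts
    that block back. *)
Lemma components_setU1 E x y :
  components ([set x; y] |: E) =
  (component E x :|: component E y) |:
    (components E :\ component E x :\ component E y).
Proof.
apply/setP => A; apply/imsetP/setU1P => [[u _ ->]|[->|]].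
- rewrite component_setU1; case: ifPn => [_|nu]; [by left|right].
  move: nu; rewrite finset.in_setU => /norP[nux nuy].
  rewrite !in_setD1 imset_f // andbT.
  by apply/andP; split; [apply: contraNneq nuy|apply: contraNneq nux] => <-;
    rewrite component_id.
- by exists x => //; rewrite component_setU1 finset.in_setU component_id.
- rewrite !in_setD1 => /and3P[ny nx /imsetP[u _ eA]].
  exists u => //; rewrite component_setU1 eA ifN //; rewrite finset.in_setU.
  by apply/norP; split; apply/negP => /component_transfer h; [move: nx|move: ny];
    rewrite eA h eqxx.
Qed.

Lemma component_in_components E x : component E x \in components E.
Proof. exact: imset_f. Qed.

Lemma merged_notin_components E x y :
  component E x :|: component E y \notin
    components E :\ component E x :\ component E y.
Proof.
rewrite !in_setD1; apply/negP => /and3P[ny nx /imsetP[u _ eA]].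
have : x \in component E u by rewrite -eA finset.in_setU component_id.
by move/component_transfer => h; move: nx; rewrite eA h eqxx.
Qed.

Lemma card_components_setU1 E x y : ~~ connect (adjacency E) x y ->
  #|components ([set x; y] |: E)|.+1 = #|components E|.
Proof.
move=> nxy; rewrite components_setU1 cardsU1 merged_notin_components.
rewrite [RHS](cardsD1 (component E x)) component_in_components.
rewrite (cardsD1 (component E y) (components E :\ component E x)) in_setD1.
by rewrite component_in_components andbT eq_sym component_eq nxy.
Qed.

Definition component_weight E := \prod_(A in components E) #|A|.

Lemma componentI0 E x y : ~~ connect (adjacency E) x y ->
  component E x :&: component E y = finset.set0.
Proof.
move=> nxy; apply/setP => z; rewrite finset.in_setI finset.in_set0.
apply/negP => /andP[/component_transfer zx /component_transfer zy].
by move: nxy; rewrite -component_eq -zx zy eqxx.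
Qed.

Lemma card_componentU E x y : ~~ connect (adjacency E) x y ->
  #|component E x :|: component E y| = #|component E x| + #|component E y|.
Proof. by move=> nxy; rewrite cardsU componentI0 // cards0 subn0. Qed.

(** The factor 1/a + 1/b for merged components of sizes a and b, cleared of denominators so as to
    live in [nat]. *)
Lemma component_weight_setU1 E x y : ~~ connect (adjacency E) x y ->
  component_weight ([set x; y] |: E) * (#|component E x| * #|component E y|) =
  component_weight E * (#|component E x| + #|component E y|).
Proof.
move=> nxy; rewrite /component_weight components_setU1.
rewrite big_setU1 ?merged_notin_components //.
rewrite [in RHS](big_setD1 (component E x)) ?component_in_components //=.
rewrite [in RHS](big_setD1 (component E y)) /=; last first.
  by rewrite in_setD1 component_in_components andbT eq_sym component_eq nxy.
by rewrite card_componentU //; lia.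
Qed.

Lemma components_partition E : finset.partition (components E) [set: V].
Proof.
apply/and3P; split.
- apply/eqP/setP => x; rewrite finset.in_setT; apply/bigcupP.
  by exists (component E x); rewrite ?component_in_components ?component_id.
- apply/finset.trivIsetP => _ _ /imsetP[x _ ->] /imsetP[y _ ->].
  rewrite component_eq => nxy; by rewrite -setI_eq0 componentI0.
- apply/imsetP => -[x _ e].
  by have := component_id E x; rewrite -e finset.in_set0.
Qed.

Lemma card_component_gt0 E x : 0 < #|component E x|.
Proof. by apply/card_gt0P; exists x; exact: component_id. Qed.

(** A component of size a contributes a copies of 1/a. *)
Lemma sum_inv_card_component (R : numFieldType) E :
  (\sum_(x : V) (#|component E x|%:R^-1 : R) = #|components E|%:R)%R.
Proof.
transitivity (\sum_(x in [set: V]) (#|component E x|%:R^-1 : R))%R.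
  by apply: eq_bigl => x; rewrite finset.in_setT.
rewrite (set_partition_big _ (components_partition E)) /=.
rewrite -sum1_card natr_sum; apply: eq_bigr => A /imsetP[x _ ->].
rewrite (eq_bigr (fun=> (#|component E x|%:R^-1)%R)); last first.
  by move=> y /component_transfer ->.
rewrite sumr_const -[LHS]mulr_natr mulVf // pnatr_eq0 -lt0n.
exact: card_component_gt0.
Qed.

End Components.

(* [{set {set V}}] elaborates to two convertible forms, which differ by a
   [reverse_coercion] and which [lia] would take for distinct atoms. *)
Ltac card_lia := unfold reverse_coercion in *; lia.

(** * Forests as extremal edge sets, and their agreement with acyclic graphs *)

Section Forests.
#[local] Set Implicit Arguments.
#[local] Unset Strict Implicit.
Local Open Scope nat_scope.
Local Open Scope set_scope.
Variable V : finType.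
Implicit Types (E F G : {set {set V}}) (e : {set V}) (x y u v : V).

Local Notation K := (complete_graph V).

Lemma complete_graphP e :
  reflect (exists x y, x != y /\ e = [set x; y]) (e \in K).
Proof. by rewrite inE; exact: cards2P. Qed.

(** The edge count rises by one, while the component count drops by at most one. *)
Lemma components_setU1_mono e E : e \in K -> e \notin E ->
  #|E| + #|components E| <= #|e |: E| + #|components (e |: E)|.
Proof.
case/complete_graphP => x [y [_ ->]] nE; rewrite cardsU1 nE.
have [xy|nxy] := boolP (connect (adjacency E) x y).
  by rewrite components_setU1_connect //; card_lia.
by have := card_components_setU1 nxy; card_lia.
Qed.

Lemma components_mono E F : E \subset F -> F \subset K ->
  #|E| + #|components E| <= #|F| + #|components F|.
Proof.
elim: {F}_.+1 {-2}F (ltnSn #|F|) => // n IHn F leFn EF FK.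
have [->//|neF] := eqVneq E F.
have /properP[_ [e eF neE]] : E \proper F by rewrite finset.properEneq neF.
have -> : F = e |: (F :\ e) by rewrite finset.setD1K.
apply: leq_trans (components_setU1_mono _ _).
- apply: IHn; first by move: leFn; rewrite (cardsD1 e F) eF; card_lia.
    by rewrite subsetD1 EF.
  exact: fintype.subset_trans (finset.subsetDl _ _) FK.
- exact: (fintype.subsetP FK).
- by rewrite in_setD1 eqxx.
Qed.

Lemma component_set0 x : component finset.set0 x = [set x].
Proof.
apply/setP => y; rewrite componentP finset.in_set1; apply/connectP/eqP.
  by case=> -[|z p] /=; [move=> _ ->|rewrite /adjacency /= finset.in_set0].
by move=> ->; exists [::].
Qed.

Lemma card_components_set0 : #|components (finset.set0 : {set {set V}})| = #|V|.
Proof.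
rewrite card_imset // => x y; rewrite !component_set0 => /setP/(_ x).
by rewrite !finset.in_set1 eqxx => /esym/eqP.
Qed.

Lemma card_components_ge E : E \subset K -> #|V| <= #|E| + #|components E|.
Proof.
by move/(components_mono (finset.sub0set E)); rewrite cards0 card_components_set0.
Qed.

(** By [card_components_ge], |V| is the least possible value of edges plus components. Acyclicity is
    encoded as reaching this minimum, so that removing or adding an edge becomes a matter of
    counting. *)
Definition forest E := (E \subset K) && (#|E| + #|components E| == #|V|).

(** Edges plus components is monotone and at least |V|, so it stays at the minimum below a
    forest. *)
Lemma forest_sub E F : E \subset F -> forest F -> forest E.
Proof.
move=> EF /andP[FK /eqP cF].
have EK : E \subset K by exact: fintype.subset_trans EF FK.
rewrite /forest EK eqn_leq card_components_ge // andbT -cF.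
exact: components_mono.
Qed.

Lemma forest0 : forest finset.set0.
Proof. by rewrite /forest finset.sub0set cards0 card_components_set0 eqxx. Qed.

(** A new edge keeps edges plus components at |V| exactly when it merges two components. *)
Lemma forest_setU1 E x y : forest E -> x != y ->
  ([set x; y] \notin E) && forest ([set x; y] |: E) =
  ~~ connect (adjacency E) x y.
Proof.
move=> /andP[EK /eqP cE] nxy; apply/andP/idP => [[nE /andP[_ /eqP]]|nc].
  rewrite cardsU1 nE; apply: contra_eqN => xy.
  by rewrite components_setU1_connect //; card_lia.
have nE : [set x; y] \notin E by apply: contraNN nc; exact: connect_edge.
split=> //; rewrite /forest finset.subUset EK finset.sub1set andbT.
apply/andP; split; first by apply/complete_graphP; exists x, y.
by rewrite cardsU1 nE; have := card_components_setU1 nc; card_lia.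
Qed.

(** An edge of a forest joins distinct components of the remaining edges, but on a cycle of length
    at least three the rest of the cycle still connects its ends. *)
Lemma forest_acyclic E : forest E -> acyclic_graph E.
Proof.
move=> fE; apply/asboolP => -[|x [|y [|z c]]] //= /andP[].
rewrite -[cycle _ _]/(path (adjacency E) x (rcons [:: y, z & c] x)) rcons_path.
move=> /andP[/and3P[xy yz zc] lx].
move=> /and3P[nx ny _].
have [nE fE'] : [set x; y] \notin E :\ [set x; y] /\ forest (E :\ [set x; y]).
  by rewrite in_setD1 eqxx; split=> //; apply: forest_sub fE;
    exact: finset.subsetDl.
have nexy : x != y by move: nx; rewrite inE negb_or => /andP[].
have := forest_setU1 fE' nexy.
rewrite nE finset.setD1K // fE => /esym/negP; case.
rewrite connect_adjC; apply/connectP; exists (rcons (z :: c) x); last first.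
  by rewrite last_rcons.
(* The way from [y] round to [x] avoids the deleted edge: its first step ends at [z], which is not
   [x]; its inner vertices differ from [x]; its last step does not start at [y]. *)
rewrite rcons_path /= -andbA; apply/and3P; split.
- rewrite /adjacency /= in_setD1 [_ \in E]yz andbT.
  apply/negP => /eqP/set2_eq[] [a b]; subst.
    by move: nexy; rewrite eqxx.
  by move: nx; rewrite !inE eqxx orbT.
- apply: (sub_in_path (P := predC1 x)) zc.
  + move=> a b ax bx ab; rewrite /adjacency /= in_setD1 [_ \in E]ab andbT.
    apply/negP => /eqP/set2_eq[] [h h']; first by move: ax; rewrite h inE eqxx.
    by move: bx; rewrite h' inE eqxx.
  + apply/allP => a ac; rewrite inE; apply: contraNneq nx => <-.
    by rewrite inE ac orbT.
- rewrite /adjacency /= in_setD1 [_ \in E]lx andbT.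
  apply/negP => /eqP/set2_eq[] [h h'].
    by move: nx; rewrite -h inE mem_last orbT.
  by move: ny; rewrite -h mem_last.
Qed.

(** Induction on the subsets of [E]: if an edge of [F] did not merge two components of the other
    edges, a simple path between its ends would close up to a cycle of [E]. *)
Lemma acyclic_forest E : E \subset K -> acyclic_graph E -> forest E.
Proof.
move=> EK /asboolP acE; rewrite /forest EK.
suff H F : F \subset E -> #|F| + #|components F| == #|V| by exact: H.
elim: {F}_.+1 {-2}F (ltnSn #|F|) => // n IHn F leFn FE.
have [->|[e eF]] := set_0Vmem F; first by rewrite cards0 card_components_set0.
have eK : e \in K by apply: (fintype.subsetP EK); exact: (fintype.subsetP FE).
case/complete_graphP: (eK) => x [y [nexy exy]].
have FE' : F :\ e \subset E by
  exact: fintype.subset_trans (finset.subsetDl _ _) FE.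
have /eqP cF' : #|F :\ e| + #|components (F :\ e)| == #|V|.
  by apply: IHn => //; move: leFn; rewrite (cardsD1 e F) eF; card_lia.
suff nc : ~~ connect (adjacency (F :\ e)) x y.
  have := card_components_setU1 nc; rewrite -exy finset.setD1K //.
  by rewrite (cardsD1 e F) eF; card_lia.
apply/negP => /connectP[p pp lp].
case/shortenP: pp lp => q pq uq _ lq.
have := acE (x :: q); apply: contraPP => _.
(* An empty path would make the edge a loop, and a path of one step would be the deleted edge
   itself; a longer one gives a cycle on at least three vertices. *)
move: pq uq lq; case: q => [|a [|b q]].
- by move=> _ _ /= yx; move: nexy; rewrite yx eqxx.
- by rewrite /= andbT => xa _ ya; move: xa;
  rewrite -ya /adjacency /= in_setD1 -exy eqxx.
move=> pq uq lq; apply/not_implyP; split=> //; rewrite /ucycle uq /= andbT.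
rewrite -[_ && _]/(path (adjacency E) x (rcons [:: a, b & q] x)).
rewrite rcons_path -lq; apply/andP; split.
  apply: sub_path pq => u v /=.
  by move/(fintype.subsetP FE').
by rewrite /adjacency /= finset.setUC -exy; exact: (fintype.subsetP FE).
Qed.

(** On an empty vertex set, connectedness is vacuous but there is no component. *)
Lemma connected_graphE E : 0 < #|V| -> connected_graph E = (#|components E| == 1).
Proof.
case/card_gt0P => x0 _; apply/idP/cards1P => [/forallP cE|[A eA]].
  exists (component E x0); apply/setP => A; rewrite finset.in_set1.
  apply/imsetP/eqP => [[x _ ->]|->]; last by exists x0.
  by apply/eqP; rewrite component_eq; have /forallP := cE x.
apply/forallP => x; apply/forallP => y; rewrite -component_eq.
have := component_in_components E x; have := component_in_components E y.
by rewrite eA !finset.in_set1 => /eqP -> /eqP ->.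
Qed.

Lemma spanning_treesE E : 0 < #|V| ->
  (E \in spanning_trees K) = forest E && (#|components E| == 1).
Proof.
move=> V0; rewrite inE connected_graphE //.
apply/and3P/andP => [[EK -> /(acyclic_forest EK)]//|[fE ->]].
by split=> //; [case/andP: fE|exact: forest_acyclic].
Qed.

End Forests.

(** * Sums over the edges joining two components of a forest *)

Section Counting.
#[local] Set Implicit Arguments.
#[local] Unset Strict Implicit.
Local Open Scope set_scope.
Variables (V : finType) (R : realFieldType).
Hypothesis V_gt0 : (0 < #|V|)%N.
Implicit Types (E F G T : {set {set V}}) (e : {set V}) (x y u v : V).

Local Notation K := (complete_graph V).
Local Notation n := (#|V|%:R : R).
Local Notation cc F := (#|components F|%:R : R).
Local Notation sz F x := (#|component F x|%:R : R).
Local Notation w F := ((component_weight F)%:R : R).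

Lemma sum_ordered_pairs (g : {set V} -> R) :
  \sum_x \sum_(y | x != y) g [set x; y] = 2 * \sum_(e in K) g e.
Proof.
rewrite (pair_big_dep xpredT (fun x y => x != y) (fun x y => g [set x; y])) /=.
rewrite (partition_big (fun p : V * V => [set p.1; p.2]) (fun e => e \in K)) /=.
  rewrite mulr_sumr; apply: eq_bigr => e /complete_graphP[a [b [nab ->]]].
  rewrite (eq_bigr (fun=> g [set a; b])); last by move=> p /andP[_ /eqP ->].
  rewrite (eq_bigl [in [set (a, b); (b, a)]]).
    by rewrite sumr_const cards2 xpair_eqE negb_and nab /= mulr_natl.
  move=> [u v]; rewrite !inE !xpair_eqE /=.
  apply/andP/orP => [[_ /eqP/set2_eq[] [-> ->]]|[] /andP[/eqP -> /eqP ->]].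
  - by left; rewrite !eqxx.
  - by right; rewrite !eqxx.
  - by rewrite nab eqxx.
  - by rewrite eq_sym nab finset.setUC eqxx.
by move=> [u v] /= nuv; apply/complete_graphP; exists u, v.
Qed.

(** By [forest_setU1], disconnected ordered pairs are the edges that extend [F] to a larger forest,
    each taken in two orders. *)
Lemma sum_forest_edges F (g : {set V} -> R) : forest F ->
  \sum_x \sum_(y | ~~ connect (adjacency F) x y) g [set x; y] =
  2 * \sum_(e in K | (e \notin F) && forest (e |: F)) g e.
Proof.
move=> fF; rewrite big_mkcondr /= -sum_ordered_pairs.
apply: eq_bigr => x _; rewrite -big_mkcondr /=; apply: eq_bigl => y.
have [<-|nxy] := eqVneq x y; first by rewrite connect0.
by rewrite forest_setU1.
Qed.

Lemma sz_gt0 F x : 0 < sz F x.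
Proof. by rewrite ltr0n card_component_gt0. Qed.

Lemma sum_disconnected F x (c : R) :
  \sum_(y | ~~ connect (adjacency F) x y) c = (n - sz F x) * c.
Proof.
rewrite sumr_const -[LHS]mulr_natl; congr (_ * _).
rewrite -(cardC (component F x)) natrD addrAC subrr add0r; congr _%:R.
by apply: eq_card => y; rewrite !inE.
Qed.

(** For fixed x in a component of size a, the n - a choices of y contribute n/a - 1 through 1/a.
    Summed over x this is n c - n, and the other reciprocal gives the same by symmetry. *)
Lemma sum_disconnected_inv F :
  \sum_x \sum_(y | ~~ connect (adjacency F) x y) ((sz F x)^-1 + (sz F y)^-1) =
  2 * n * (cc F - 1).
Proof.
have H : \sum_x \sum_(y | ~~ connect (adjacency F) x y) (sz F x)^-1 =
    n * (cc F - 1).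
  under eq_bigr => x _ do
    rewrite sum_disconnected mulrBl (divff (lt0r_neq0 (sz_gt0 F x))).
  by rewrite sumrB sumr_const -mulr_sumr sum_inv_card_component mulrBr mulr1.
under eq_bigr => x _ do rewrite big_split /=.
rewrite big_split /= H (exchange_big_dep xpredT) //=.
under eq_bigr => y _ do (under eq_bigl => x do rewrite connect_adjC).
by rewrite H; ring.
Qed.

Lemma w_setU1 F x y : ~~ connect (adjacency F) x y ->
  w ([set x; y] |: F) = w F * ((sz F x)^-1 + (sz F y)^-1).
Proof.
move=> nc; have := sz_gt0 F x; have := sz_gt0 F y; move=> y0 x0.
have /(congr1 (fun k => k%:R : R)) := component_weight_setU1 nc.
rewrite !natrM natrD => h.
apply: (mulIf (x := sz F x * sz F y)); first by rewrite mulf_neq0 ?gt_eqF.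
by rewrite h; field; rewrite !gt_eqF.
Qed.

(** * Spanning trees containing a given forest *)

Definition ntrees F := #|[set T in spanning_trees K | F \subset T]|.

(** Double counting of pairs of a tree [T] containing [F] and an edge of [T] outside [F]: there are
    c - 1 such edges when [F] has c components. *)
Lemma sum_ntrees_setU1 F : forest F ->
  (\sum_(e in K | (e \notin F) && forest (e |: F)) ntrees (e |: F) =
   #|components F|.-1 * ntrees F)%N.
Proof.
move=> fF; rewrite mulnC -sum_nat_const.
transitivity (\sum_(T in [set T in spanning_trees K | F \subset T])
   \sum_(e in T :\: F) 1)%N; last first.
  apply: eq_bigr => T; rewrite finset.in_set spanning_treesE //.
  case/andP => /andP[/andP[_ /eqP cT] /eqP c1] FT.
  rewrite sum1_card cardsDS //; case/andP: fF => _ /eqP.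
  by move: cT; rewrite c1; card_lia.
rewrite (exchange_big_dep
  (fun e => (e \in K) && ((e \notin F) && forest (e |: F)))) /=.
  apply: eq_bigr => e /and3P[eK neF fe].
  rewrite /ntrees -sum1_card; apply: eq_bigl => T.
  rewrite !finset.in_set finset.subUset finset.sub1set neF /=.
  by rewrite -!andbA [(e \in T) && _]andbC.
move=> T e; rewrite finset.in_set spanning_treesE // => /andP[/andP[fT _] FT].
rewrite finset.in_setD => /andP[neF eT]; rewrite neF /=.
case/andP: (fT) => TK _; rewrite (fintype.subsetP TK) //=.
by apply: forest_sub fT; rewrite finset.subUset finset.sub1set eT.
Qed.

Lemma components_full F : #|components F| = 1%N -> components F = [set [set: V]].
Proof.
move=> /eqP/cards1P[A eA]; rewrite eA; congr [set _]; apply/setP => x.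
by have := component_in_components F x; have := component_id F x;
  rewrite eA finset.in_set1 finset.in_setT => xx /eqP <-.
Qed.

Lemma ntrees_tree F : forest F -> #|components F| = 1%N -> ntrees F = 1%N.
Proof.
move=> fF c1; apply/eqP/cards1P; exists F; apply/setP => T.
rewrite finset.in_set finset.in_set1 spanning_treesE //.
apply/idP/eqP => [/andP[/andP[/andP[_ /eqP cT] /eqP c1']] FT|->].
  apply/eqP; rewrite eq_sym eqEcard FT /=.
  case/andP: fF => _ /eqP cF; rewrite c1 in cF; rewrite c1' in cT.
  exact/eq_leq/(@addIn 1%N)/(etrans cT (esym cF)).
by rewrite fF c1 eqxx fintype.subxx.
Qed.

(** The factor n^2 stands on the left because the exponent c - 2 is negative for a tree. The
    induction multiplies by 2 (c - 1), passes to forests with one component fewer by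
    [sum_ntrees_setU1], and adds up their weights by [sum_disconnected_inv]. *)
Lemma ntrees_forest F : forest F ->
  (ntrees F)%:R * n ^+ 2 = n ^+ #|components F| * w F.
Proof.
have n0 : n != 0 by rewrite pnatr_eq0 -lt0n.
elim: {F}_.+1 {-2}F (ltnSn #|components F|) => // k IHk F leFk fF.
have c0 : (0 < #|components F|)%N.
  case/card_gt0P: V_gt0 => x _; apply/card_gt0P; exists (component F x).
  exact: component_in_components.
have [c1|c1] := eqVneq #|components F| 1%N.
  rewrite ntrees_tree // c1 /component_weight (components_full c1) big_set1.
  by rewrite cardsT mul1r.
have cE : cc F = #|components F|.-1%:R + 1 by rewrite natr1 prednK.
have c1' : (#|components F|.-1%:R : R) != 0 by rewrite pnatr_eq0; lia.
apply: (mulfI c1'); apply: (mulfI (x := 2)); first by rewrite pnatr_eq0.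
transitivity (\sum_x \sum_(y | ~~ connect (adjacency F) x y)
    n ^+ #|components F|.-1 * w F * ((sz F x)^-1 + (sz F y)^-1)).
  rewrite (mulrA _ (ntrees F)%:R) -natrM -sum_ntrees_setU1 // natr_sum mulr_suml.
  rewrite -(sum_forest_edges (fun e => (ntrees (e |: F))%:R * n ^+ 2)) //.
  apply: eq_bigr => x _; apply: eq_bigr => y nc.
  have nxy : x != y by apply: contraNneq nc => ->; rewrite connect0.
  have := forest_setU1 fF nxy; rewrite nc => /andP[_ fU].
  have cU := card_components_setU1 nc.
  rewrite IHk //; last by move: leFk; rewrite -cU.
  by rewrite w_setU1 // mulrA -cU.
under eq_bigr => x _ do rewrite -mulr_sumr.
rewrite -mulr_sumr sum_disconnected_inv cE.
by case: #|components F| c0 => // c' _; rewrite exprS /=; ring.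
Qed.

Lemma card_spanning_trees : ntrees finset.set0 = #|spanning_trees K|.
Proof.
by apply: eq_card => T; rewrite finset.in_set finset.sub0set andbT.
Qed.

(** * Weighted forest sums, which are the overlap's binomial moments up to scaling *)

Definition forest_moment (k : nat) :=
  \sum_(F : {set {set V}} | forest F && (#|F| == k)) w F ^+ 2.

(** Each forest with k + 1 edges arises from k + 1 smaller ones, by deleting any of its edges. *)
Lemma sum_forestS k (h : {set {set V}} -> R) :
  k.+1%:R * \sum_(G : {set {set V}} | forest G && (#|G| == k.+1)) h G =
  \sum_(F : {set {set V}} | forest F && (#|F| == k))
    \sum_(e in K | (e \notin F) && forest (e |: F)) h (e |: F).
Proof.
transitivity
  (\sum_(G : {set {set V}} | forest G && (#|G| == k.+1)) \sum_(e in G) h G).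
  rewrite mulr_sumr; apply: eq_bigr => G /andP[_ /eqP cG].
  by rewrite sumr_const cG mulr_natl.
rewrite (exchange_big_dep (mem K)) /=; last first.
  by move=> G e /andP[/andP[GK _] _]; exact: (fintype.subsetP GK).
rewrite [RHS](exchange_big_dep (mem K)) /=; last by move=> F e _ /andP[].
apply: eq_bigr => e eK.
rewrite (reindex_onto (fun F => e |: F) (fun G => G :\ e)) /=; last first.
  by move=> G /andP[_ eG]; rewrite finset.setD1K.
apply: eq_bigl => F; rewrite setU11 andbT eK /=.
have [eF|neF] := boolP (e \in F).
  rewrite [RHS]andbF; apply/negP => /andP[_ /eqP/setP/(_ e)].
  by rewrite in_setD1 eqxx eF.
rewrite cardsU1 neF setU1K // eqxx andbT add1n eqSS /=.
apply/andP/andP => [[fe ->]|[/andP[fF ->] ->] //]; rewrite fe andbT; split=> //.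
by apply: forest_sub fe; exact: finset.subsetUr.
Qed.

Lemma forest_momentS k :
  (2 * n ^+ 2 - 4 * n * k.+1%:R) * forest_moment k <=
    k.+1%:R * forest_moment k.+1 <= 2 * n ^+ 2 * forest_moment k.
Proof.
have -> : k.+1%:R * forest_moment k.+1 =
    \sum_(F : {set {set V}} | forest F && (#|F| == k))
    w F ^+ 2 * (2^-1 * \sum_x \sum_(y | ~~ connect (adjacency F) x y)
      ((sz F x)^-1 + (sz F y)^-1) ^+ 2).
  rewrite sum_forestS; apply: eq_bigr => F /andP[fF _].
  apply: (mulfI (x := 2)); first by rewrite pnatr_eq0.
  rewrite -(sum_forest_edges (fun e => w (e |: F) ^+ 2)) //.
  rewrite mulrCA mulVKf ?pnatr_eq0 // mulr_sumr; apply: eq_bigr => x _.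
  rewrite mulr_sumr; apply: eq_bigr => y nc.
  by rewrite w_setU1 // exprMn.
have sz1 F x : (sz F x)^-1 <= 1.
  by rewrite invf_le1 ?sz_gt0 // ler1n card_component_gt0.
have sz0 F x : 0 <= (sz F x)^-1 by rewrite invr_ge0 ltW // sz_gt0.
rewrite /forest_moment !mulr_sumr; apply/andP; split.
  apply: ler_sum => F /andP[/andP[FK /eqP cF] /eqP kF].
  rewrite mulrC; apply: ler_wpM2l; first exact: sqr_ge0.
  have cE : cc F = n - k%:R by rewrite -cF kF natrD addrC addKr.
  have pairs_le :
    \sum_x \sum_(y | ~~ connect (adjacency F) x y) (1 : R) <= n ^+ 2.
    apply: (@le_trans _ _ (\sum_(x : V) \sum_(y : V) 1)).
      apply: ler_sum => x _; rewrite big_mkcond; apply: ler_sum => y _.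
      by case: ifP.
    by rewrite !sumr_const -[leLHS]mulr_natr -expr2.
  rewrite ler_pdivlMl //.
  (* [t ^ 2 >= 4 * t - 4] reduces the square to [sum_disconnected_inv] *)
  apply: (@le_trans _ _ (\sum_x \sum_(y | ~~ connect (adjacency F) x y)
      (4 * ((sz F x)^-1 + (sz F y)^-1) - 4 * 1))).
    under eq_bigr => x _ do rewrite sumrB -!mulr_sumr.
    (* With n - k components and at most n^2 pairs, the sum is at least 8 n (n - k - 1) - 4 n^2,
       which is twice the required coefficient. *)
    rewrite sumrB -!mulr_sumr sum_disconnected_inv cE -natr1.
    by nra.
  apply: ler_sum => x _; apply: ler_sum => y _.
  by rewrite -subr_ge0 (_ : _ - _ = ((sz F x)^-1 + (sz F y)^-1 - 2) ^+ 2)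
     ?sqr_ge0 //; ring.
apply: ler_sum => F _.
rewrite [leRHS]mulrC; apply: ler_wpM2l; first exact: sqr_ge0.
rewrite ler_pdivrMl //.
apply: (@le_trans _ _ (\sum_(x : V) \sum_(y : V) 4)).
  apply: ler_sum => x _; rewrite big_mkcond; apply: ler_sum => y _.
  case: ifP => // _; have := sz1 F x; have := sz1 F y; have := sz0 F x.
  by have := sz0 F y; nra.
rewrite !sumr_const -[leLHS]mulr_natr -[4 *+ _]mulr_natr.
by rewrite le_eqVlt; apply/orP; left; apply/eqP; ring.
Qed.

Lemma forest_moment0 : forest_moment 0 = 1.
Proof.
rewrite /forest_moment (big_pred1 finset.set0) => [|F]; last first.
  rewrite cards_eq0 /=; case: eqP => [->|]; last by rewrite andbF.
  by rewrite forest0.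
rewrite /component_weight big1 ?expr1n // => A /imsetP[x _ ->].
by rewrite component_set0 cards1.
Qed.

Lemma forest_moment_bounds k :
  2 ^+ k / k`!%:R * (1 - (k * k.+1)%:R / n) <= forest_moment k / n ^+ k.*2
    <= 2 ^+ k / k`!%:R.
Proof.
have n0 : 0 < n by rewrite ltr0n.
elim: k => [|k /andP[lo up]].
  by rewrite forest_moment0 !mul0n expr0 mul0r subr0 !divr1 mulr1 lexx.
have /andP[lo' up'] := forest_momentS k.
have k0 : 0 < k.+1%:R :> R by rewrite ltr0n.
have nk0 : 0 < n ^+ k.*2 by rewrite exprn_gt0.
set s := forest_moment k in lo up lo' up' *.
set s' := forest_moment k.+1 in lo' up' *.
set p := 2 ^+ k / k`!%:R in lo up *.
have -> : 2 ^+ k.+1 / k.+1`!%:R = 2 / k.+1%:R * p.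
  by rewrite /p exprS factS natrM invfM mulrACA.
rewrite doubleS !exprS.
have -> : s' / (n * (n * n ^+ k.*2)) =
    (k.+1%:R * s') / n ^+ k.*2 / n ^+ 2 / k.+1%:R.
  move: (lt0r_neq0 k0); move: (k.+1%:R : R) => y y0.
  by field; rewrite y0 !gt_eqF.
set q := s / n ^+ k.*2 in lo up.
have lo2 : (2 * n ^+ 2 - 4 * n * k.+1%:R) * q <= k.+1%:R * s' / n ^+ k.*2.
  by rewrite /q mulrA ler_pM2r ?invr_gt0.
have up2 : k.+1%:R * s' / n ^+ k.*2 <= 2 * n ^+ 2 * q.
  by rewrite /q mulrA ler_pM2r ?invr_gt0.
rewrite -[2 / _ * p]mulrAC -[leLHS]mulrAC !ler_pM2r ?invr_gt0 //.
rewrite ler_pdivlMr ?exprn_gt0 // ler_pdivrMr ?exprn_gt0 //.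
apply/andP; split.
  apply: le_trans lo2.
  (* The coefficient 2 n^2 - 4 n (k + 1) may be negative, so its terms are treated apart: the first
     uses the lower bound on [q], the second the upper bound. *)
  rewrite mulrBl.
  have : 4 * n * k.+1%:R * q <= 4 * n * k.+1%:R * p.
    by rewrite ler_pM2l // !mulr_gt0.
  have : 2 * n ^+ 2 * (p * (1 - (k * k.+1)%:R / n)) <= 2 * n ^+ 2 * q.
    by rewrite ler_pM2l // !mulr_gt0 ?exprn_gt0.
  (* Each step adds a relative loss of 2 (k + 1) / n, which accumulates to k (k + 1) / n. *)
  have -> : (k.+1 * k.+2)%:R = (k * k.+1)%:R + 2 * k.+1%:R :> R.
    by rewrite -natrM -natrD; congr _%:R; lia.
  move=> h1 h2; apply: le_trans (lerB h1 h2).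
  by rewrite le_eqVlt; apply/orP; left; apply/eqP; field; rewrite gt_eqF.
apply: le_trans up2 _.
rewrite [leRHS](_ : _ = 2 * n ^+ 2 * p); last by ring.
by rewrite ler_pM2l // !mulr_gt0 ?exprn_gt0.
Qed.

End Counting.

(** * Inversion of binomial moments *)

Section BinomialInversion.
Variable R : comNzRingType.

Lemma sum_alt_bin n N : (n < N)%N ->
  \sum_(j < N) (-1) ^+ j * 'C(n, j)%:R = (n == 0)%:R :> R.
Proof.
move=> nN; transitivity (\sum_(j < n.+1) (-1) ^+ j * 'C(n, j)%:R : R).
  rewrite (big_ord_widen _ (fun j => (-1) ^+ j * 'C(n, j)%:R : R) nN).
  rewrite [RHS]big_mkcond.
  apply: eq_bigr => j _; case: ltnP => // nj.
  by rewrite bin_small // mulr0.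
rewrite -expr0n -[0 in RHS](addrN (1 : R)) [RHS]exprDn; apply: eq_bigr => j _.
by rewrite expr1n mul1r mulr_natr.
Qed.

(** Both sides are a! / (m! j! (a - m - j)!), or zero when j exceeds a - m. *)
Lemma bin_mul_bin a m j : (m <= a)%N ->
  ('C(m + j, m) * 'C(a, m + j) = 'C(a, m) * 'C(a - m, j))%N.
Proof.
move=> ma; have [ja|ja] := leqP j (a - m); last first.
  by rewrite !(bin_small (m := m + j)) ?(bin_small (m := j)) ?muln0 //; lia.
have h1 : ('C(m + j, m) * (m`! * j`!) = (m + j)`!)%N.
  by rewrite -{2}(addKn m j) bin_fact // leq_addr.
have h2 := @bin_fact a (m + j) ltac:(lia).
have h3 := bin_fact ma.
have h4 := bin_fact ja.
have e : (a - (m + j) = a - m - j)%N by lia.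
rewrite e in h2.
apply/eqP; rewrite -(eqn_pmul2r (m := m`! * j`! * (a - m - j)`!)); last first.
  by rewrite !muln_gt0 !fact_gt0.
apply/eqP; transitivity a`!.
  by rewrite -h2 -h1; ring.
by rewrite -h3 -h4; ring.
Qed.

(** After [bin_mul_bin], what remains is C(a, m) times the alternating sum of row a - m, which
    vanishes unless a = m. *)
Lemma bin_inversion a m N : (a < N)%N ->
  \sum_(j < N) (-1) ^+ j * 'C(m + j, m)%:R * 'C(a, m + j)%:R =
  (a == m)%:R :> R.
Proof.
move=> aN; have [ma|am] := leqP m a; last first.
  rewrite big1 ?(ltn_eqF am) // => j _.
  by rewrite (bin_small (m := m + j)) ?mulr0 // ltn_addr.
under eq_bigr => j _ do rewrite -mulrA -natrM bin_mul_bin // natrM mulrCA.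
rewrite -mulr_sumr sum_alt_bin; last by lia.
have [->|am] := eqVneq a m; first by rewrite subnn binn mulr1.
by rewrite (_ : (_ == 0)%N = false) ?mulr0 //; lia.
Qed.

End BinomialInversion.

(** * Exact law of the overlap in terms of forest sums *)

Section OverlapLaw.
#[local] Set Implicit Arguments.
#[local] Unset Strict Implicit.
Local Open Scope set_scope.
Variables (V : finType) (R : realFieldType).
Hypothesis V_gt0 : (0 < #|V|)%N.
Implicit Types (E F G T : {set {set V}}).

Local Notation K := (complete_graph V).
Local Notation n := (#|V|%:R : R).
Local Notation ST := (spanning_trees K).

Lemma component_weight0 :
  component_weight (finset.set0 : {set {set V}}) = 1%N.
Proof.
rewrite /component_weight big1 // => A /imsetP[x _ ->].
by rewrite component_set0 cards1.
Qed.

Lemma ntrees_not_forest F : ~~ forest F -> ntrees F = 0%N.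
Proof.
move=> nF; apply/eqP; rewrite cards_eq0; apply/eqP/setP => T.
rewrite finset.in_set finset.in_set0 spanning_treesE //.
apply/negP => /andP[/andP[fT _] FT]; move: nF.
by rewrite (forest_sub FT fT).
Qed.

(** Cayley's formula, multiplied through by n^2. *)
Lemma ntrees_set0 :
  (ntrees (finset.set0 : {set {set V}}))%:R * n ^+ 2 = n ^+ #|V|.
Proof.
rewrite [LHS](ntrees_forest R V_gt0 (forest0 V)).
by rewrite component_weight0 card_components_set0 mulr1.
Qed.

Lemma ntrees_set0_neq0 : (ntrees (finset.set0 : {set {set V}}))%:R != 0 :> R.
Proof.
have n0 : n != 0 by rewrite pnatr_eq0 -lt0n.
by apply/eqP => t0; move: (expf_neq0 #|V| n0); rewrite -ntrees_set0 t0 mul0r eqxx.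
Qed.

(** A uniform spanning tree thus contains [F] with probability w(F) / n^|F|; this compares
    [ntrees_forest] at [F] and at the empty forest. *)
Lemma ntrees_forest_set0 F : forest F ->
  (ntrees F)%:R = (component_weight F)%:R / n ^+ #|F| *
    (ntrees (finset.set0 : {set {set V}}))%:R :> R.
Proof.
move=> fF; have n0 : n != 0 by rewrite pnatr_eq0 -lt0n.
apply: (mulIf (expf_neq0 2 n0)); rewrite ntrees_forest // -[RHS]mulrA ntrees_set0.
case/andP: fF => _ /eqP cF.
have -> : n ^+ #|V| = n ^+ #|F| * n ^+ #|components F| by rewrite -exprD cF.
by rewrite [RHS]mulrA mulfVK 1?mulrC // expf_neq0.
Qed.

Definition overlap_prob m : R :=
  (\sum_(T in ST) \sum_(U in ST) (#|T :&: U| == m)%:R) / #|ST|%:R ^+ 2.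

(** The binomial coefficient counts the k-edge sets contained in both trees; exchanging sums leaves,
    for each set, the pairs of trees containing it. *)
Lemma sum_bin_overlap k :
  \sum_(T in ST) \sum_(U in ST) 'C(#|T :&: U|, k)%:R =
  \sum_(F : {set {set V}} | #|F| == k) (ntrees F)%:R ^+ 2 :> R.
Proof.
transitivity (\sum_(T in ST) \sum_(U in ST)
    \sum_(F : {set {set V}} | #|F| == k) ((F \subset T) && (F \subset U))%:R : R).
  apply: eq_bigr => T _; apply: eq_bigr => U _.
  rewrite -cards_draws -sum1_card natr_sum big_mkcond [RHS]big_mkcond.
  apply: eq_bigr => F _; rewrite finset.in_set finset.subsetI.
  by case: eqP; rewrite ?andbT ?andbF //; case: ifP.
under eq_bigr => T _ do rewrite exchange_big.
rewrite exchange_big; apply: eq_bigr => F _.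
have ntE : (ntrees F)%:R = \sum_(T in ST) (F \subset T)%:R :> R.
  rewrite /ntrees -sum1_card natr_sum.
  rewrite [RHS](eq_bigr (fun T => if F \subset T then 1 else 0 : R)).
    rewrite -big_mkcondr; apply: eq_bigl => T.
    by rewrite finset.in_set.
  by move=> T _; case: ifP.
rewrite expr2 {1}ntE mulr_suml; apply: eq_bigr => T _.
rewrite ntE mulr_sumr; apply: eq_bigr => U _.
by rewrite -natrM mulnb.
Qed.

Lemma factorial_moment k :
  (\sum_(T in ST) \sum_(U in ST) 'C(#|T :&: U|, k)%:R) / #|ST|%:R ^+ 2 =
  forest_moment V R k / n ^+ k.*2.
Proof.
rewrite sum_bin_overlap -card_spanning_trees.
have t0 := ntrees_set0_neq0.
rewrite (bigID (@forest V)) /= [X in _ + X]big1 ?addr0; last first.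
  by move=> F /andP[_ nF]; rewrite ntrees_not_forest // expr0n.
rewrite /forest_moment !mulr_suml.
rewrite (eq_bigl (fun F => forest F && (#|F| == k))); last
  by move=> F; rewrite andbC.
apply: eq_bigr => F /andP[fF /eqP <-].
rewrite ntrees_forest_set0 // exprMn mulfK ?expf_neq0 //.
by rewrite expr_div_n -exprM muln2.
Qed.

Lemma overlap_probE m : overlap_prob m =
  \sum_(j < #|V|) (-1) ^+ j * 'C(m + j, m)%:R *
    (forest_moment V R (m + j) / n ^+ (m + j).*2).
Proof.
rewrite /overlap_prob.
under [RHS]eq_bigr => j _ do rewrite -factorial_moment mulrA mulr_sumr.
rewrite -mulr_suml; congr (_ / _).
under [RHS]eq_bigr => j _ do (under eq_bigr => T _ do rewrite mulr_sumr).
rewrite [RHS]exchange_big; apply: eq_bigr => T TT.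
rewrite [RHS]exchange_big; apply: eq_bigr => U _ /=.
(* A tree has |V| - 1 edges, so the overlap is below the cutoff |V| of the sum. *)
rewrite bin_inversion //.
move: TT; rewrite spanning_treesE // => /andP[/andP[_ /eqP cT] /eqP c1].
have := subset_leq_card (finset.subsetIl T U).
by move=> h; apply: (leq_ltn_trans h); rewrite -cT c1 addn1.
Qed.

End OverlapLaw.

(** * Convergence of the overlap law at rate O(1/n) *)

Section OverlapLimit.
Variable R : realType.

Lemma bin_mul_exp (x : R) m j :
  'C(m + j, m)%:R * (x ^+ (m + j) / (m + j)`!%:R) =
  x ^+ m / m`!%:R * (x ^+ j / j`!%:R).
Proof.
have f0 k : (k`!%:R : R) != 0 by rewrite pnatr_eq0 -lt0n fact_gt0.
have : 'C(m + j, m)%:R * (m`!%:R * j`!%:R) = (m + j)`!%:R :> R.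
  by rewrite -!natrM -{2}(addKn m j) bin_fact // leq_addr.
move=> <-; rewrite exprD; field.
by rewrite !f0 pnatr_eq0 -lt0n bin_gt0 leq_addr.
Qed.

Lemma expRN2 : expR (- 2) = (expR 1 ^+ 2)^-1 :> R.
Proof. by rewrite expRN -expRM_natr mul1r. Qed.

(** This turns the moment error k (k + 1) 2^k / k! into 2 * 4^k / k!, whose series is
    exponential. *)
Lemma mulnS_le_expn k : (k * k.+1 <= 2 * 2 ^ k)%N.
Proof.
elim: k => // k IHk; rewrite expnS.
by have := ltn_expl k (isT : (1 < 2)%N); lia.
Qed.

Lemma series_exp_coeff_le (x : R) n : 0 <= x ->
  \sum_(j < n) (x ^+ j / j`!%:R) <= expR x.
Proof.
move=> x0; rewrite -(big_mkord xpredT (fun j => x ^+ j / j`!%:R)).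
apply: (nondecreasing_cvgn_le _ (is_cvg_series_exp_coeff x)).
by apply: nondecreasing_series => k _ _; exact: exp_coeff_ge0.
Qed.

(** Replacing each moment in [overlap_probE] by 2^k / k! costs at most 2 * 4^k / (k! n), and
    [bin_mul_exp] factors m out of both the main and the error series. *)
Lemma overlap_prob_bound (V : finType) m : (0 < #|V|)%N ->
  `|overlap_prob V R m - 2 ^+ m / m`!%:R * \sum_(j < #|V|) ((-2) ^+ j / j`!%:R)|
    <= 2 * (4 ^+ m / m`!%:R) * expR 4 / #|V|%:R.
Proof.
move=> V_gt0; rewrite overlap_probE // mulr_sumr -sumrB.
apply: le_trans (ler_norm_sum _ _ _) _.
apply: (@le_trans _ _ (\sum_(j < #|V|)
    2 * (4 ^+ m / m`!%:R) / #|V|%:R * (4 ^+ j / j`!%:R))); last first.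
  rewrite -mulr_sumr [leRHS]mulrAC; apply: ler_wpM2l.
    by rewrite !mulr_ge0 ?invr_ge0 ?exprn_ge0 // ?ler0n.
  exact: series_exp_coeff_le.
apply: ler_sum => j _.
have -> : 2 ^+ m / m`!%:R * ((-2) ^+ j / j`!%:R) =
    (-1) ^+ j * 'C(m + j, m)%:R * (2 ^+ (m + j) / (m + j)`!%:R) :> R.
  by rewrite -[RHS]mulrA bin_mul_exp exprNn; ring.
rewrite -mulrBr !normrM normrX normrN1 expr1n mul1r normr_nat.
have -> : 2 * (4 ^+ m / m`!%:R) / #|V|%:R * (4 ^+ j / j`!%:R) =
    'C(m + j, m)%:R * (2 * (4 ^+ (m + j) / (m + j)`!%:R) / #|V|%:R) :> R.
  transitivity
    (2 * ('C(m + j, m)%:R * (4 ^+ (m + j) / (m + j)`!%:R)) / #|V|%:R : R).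
    by rewrite bin_mul_exp; ring.
  by ring.
rewrite ler_wpM2l ?ler0n //; set k := (m + j)%N.
have /andP[lo up] := forest_moment_bounds R V_gt0 k.
rewrite distrC ger0_norm ?subr_ge0 //.
apply: (@le_trans _ _ (2 ^+ k / k`!%:R * ((k * k.+1)%:R / #|V|%:R))).
  by rewrite lerBlDr -lerBlDl; apply: le_trans lo; rewrite mulrBr mulr1.
rewrite [leRHS](_ : _ = 2 ^+ k / k`!%:R * ((2 * 2 ^ k)%:R / #|V|%:R)).
  rewrite ler_wpM2l ?divr_ge0 ?exprn_ge0 ?ler0n //.
  by rewrite ler_wpM2r ?invr_ge0 ?ler0n // ler_nat mulnS_le_expn.
by rewrite natrM natrX (_ : 4 = 2 * 2) ?exprMn; ring.
Qed.

Lemma cvg_overlap_prob m :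
  (overlap_prob 'I_n R m : R) @[n --> \oo] --> 2 ^+ m / (expR 1 ^+ 2 * m`!%:R).
Proof.
(* The shift makes the vertex set nonempty and matches [harmonic n], which is 1 / (n + 1). *)
rewrite -cvg_shiftS /=.
have -> : 2 ^+ m / (expR 1 ^+ 2 * m`!%:R) = 2 ^+ m / m`!%:R * expR (- 2) :> R.
  by rewrite expRN2 invfM; ring.
pose u n : R := 2 ^+ m / m`!%:R * \sum_(j < n) ((-2) ^+ j / j`!%:R).
pose C : R := 2 * (4 ^+ m / m`!%:R) * expR 4.
have cu : u n.+1 @[n --> \oo] --> 2 ^+ m / m`!%:R * expR (- 2).
  rewrite (cvg_shiftS u); apply: cvgMr.
  rewrite (_ : (fun n => _) = series (exp_coeff (- 2))).
    exact: is_cvg_series_exp_coeff.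
  by apply/funext => n; rewrite /series /= big_mkord.
have cC : C * harmonic n @[n --> \oo] --> (0 : R).
  by rewrite -(mulr0 C); apply: cvgMr; exact: cvg_harmonic.
apply: (@squeeze_cvgr _ _ _ _ (fun n => u n.+1 - C * harmonic n)
  (fun n => u n.+1 + C * harmonic n)).
- apply: nearW => n; rewrite -ler_distl.
  have := @overlap_prob_bound 'I_n.+1 m.
  by rewrite card_ord => /(_ isT).
- by rewrite -[X in _ --> X]subr0; exact: cvgB.
- by rewrite -[X in _ --> X]addr0; exact: cvgD.
Qed.

End OverlapLimit.

(** * Passage from tree counts to probabilities *)

Section FiniteUnions.
Context d (T : measurableType d) (R : realType) (P : probability T R).

Lemma measure_bigcup_fin (I : finType) (D : pred I) (F : I -> set T) :
  (forall i, measurable (F i)) -> trivIset setT F ->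
  P (\bigcup_(i in [set i | D i]) F i) = (\sum_(i | D i) P (F i))%E.
Proof.
move=> mF tF.
have -> : [set i | D i] = [set` enum D].
  by apply/seteqP; split=> i /=; rewrite mem_enum.
rewrite measure_fin_bigcup //; last exact: sub_trivIset tF.
by rewrite -fsbig_seq ?enum_uniq // big_enum.
Qed.

Lemma cdf_natE (X : {RV P >-> R}) (f : T -> nat) (x : R) N :
  (forall w, X w = (f w)%:R) -> (forall k, (k < N)%N = (k%:R <= x)) ->
  cdf X x = (\sum_(k < N) P [set w | X w = k%:R])%E.
Proof.
move=> Xf Nx.
have mX k : measurable [set w | X w = k%:R] by
  exact: (measurable_funPTI X (measurable_set1 (k%:R : R))).
rewrite -(@measure_bigcup_fin 'I_N xpredT (fun k => [set w | X w = k%:R])) //.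
  rewrite /cdf /distribution /pushforward; congr (P _).
  apply/seteqP; split=> [w /=|w [k _ /= ->]].
    rewrite in_itv /= Xf => fx.
    have kN : (f w < N)%N by rewrite Nx.
    by exists (Ordinal kN).
  by rewrite in_itv /= -Nx.
apply/trivIsetP => i j _ _ ij; apply/seteqP; split=> w //= [-> /eqP].
by rewrite eqr_nat => /eqP/val_inj/eqP; rewrite (negbTE ij).
Qed.

(** The event splits over the finitely many values of the pair (X, Y); independence and uniformity
    give each pair of trees the same mass and every other pair mass zero. *)
Lemma prob_common_edges (V : finType) (X Y : {RV P >-> edge_set V}) m :
  (0 < #|V|)%N ->
  uniform_on (spanning_trees (complete_graph V)) X ->
  uniform_on (spanning_trees (complete_graph V)) Y ->
  independent_RV X Y ->
  P [set w | common_edges X Y w = m%:R] = (overlap_prob V R m)%:E.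
Proof.
move=> V_gt0 uX uY iXY.
pose D (p : edge_set V * edge_set V) := #|(p.1 :&: p.2)%SET| == m.
pose F (p : edge_set V * edge_set V) := X @^-1` [set p.1] `&` Y @^-1` [set p.2].
have -> : [set w | common_edges X Y w = m%:R] = \bigcup_(p in [set p | D p]) F p.
  apply/seteqP; split=> [w /= /eqP|w [p /= /eqP Dp [/= Xp Yp]]].
    by rewrite /common_edges eqr_nat => XYm; exists (X w, Y w).
  by rewrite /common_edges Xp Yp Dp.
rewrite measure_bigcup_fin; last 2 first.
- by move=> p; apply: measurableI; exact: measurable_funPTI.
- move=> [E1 F1] [E2 F2] _ _ [w [[/= X1 Y1] [/= X2 Y2]]].
  by rewrite -X1 -Y1 X2 Y2.
set ST := spanning_trees _ in uX uY *.
have PF p : P (F p) =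
    ((if p.1 \in ST then #|ST|%:R^-1 else 0) *
     (if p.2 \in ST then #|ST|%:R^-1 else 0))%:E.
  by rewrite iXY // uX uY.
under eq_bigr => p _ do rewrite PF.
rewrite sumEFin; congr EFin.
rewrite big_mkcond /=.
rewrite -(pair_bigA _ (fun E F => if D (E, F) then
  (if E \in ST then #|ST|%:R^-1 else 0) *
  (if F \in ST then #|ST|%:R^-1 else 0) else 0 : R)) /=.
rewrite /overlap_prob mulr_suml [RHS]big_mkcond; apply: eq_bigr => E _.
case: (E \in _); last by rewrite big1 // => G _; rewrite mul0r if_same.
rewrite mulr_suml [RHS]big_mkcond; apply: eq_bigr => G _.
rewrite /D /=; case: (G \in _); case: eqP => _; rewrite ?mulr0 ?mul0r //.
by rewrite mul1r expr2 invfM.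
Qed.

End FiniteUnions.

(** * Poisson point masses and convergence in distribution *)

Lemma poisson_prob_natRV (R : realType) m :
  (poisson_prob 2 0%N : probability nat R) [set k | poisson_RV (2 : R) k = m%:R] =
  (2 ^+ m / (expR 1 ^+ 2 * m`!%:R))%:E.
Proof.
have -> : [set k | poisson_RV (2 : R) k = m%:R] = [set m].
  by apply/seteqP; split=> [k /= /eqP|k /= ->] //; rewrite eqr_nat => /eqP.
(* This is [poisson_prob] unfolded; a Dirac mass at 0 is its default for nonpositive rates. *)
transitivity (if 0 < (2 : R) then \esum_(k in [set m]) (poisson_pmf (2 : R) k)%:E
  else (\d_0%N [set m])); first by [].
rewrite ltr0n esum_set1; last by rewrite lee_fin poisson_pmf_ge0.
congr EFin; rewrite /poisson_pmf ifT ?ltr0n // expRN2.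
by rewrite (invfM (expR 1 ^+ 2)) [RHS]mulrA [RHS]mulrAC.
Qed.

Lemma cvg_sum_fin (R : realType) N (f : nat -> nat -> \bar R) (l : nat -> R) :
  (forall k, f k n @[n --> \oo] --> (l k)%:E) ->
  (\sum_(k < N) f k n)%E @[n --> \oo] --> (\sum_(k < N) (l k)%:E)%E.
Proof.
move=> fl; elim: N => [|N IHN].
  by rewrite big_ord0; under eq_fun do rewrite big_ord0; exact: cvg_cst.
rewrite big_ord_recr /=; under eq_fun do rewrite big_ord_recr /=.
apply: cvgeD => //; exact: fin_num_adde_defl.
Qed.

Lemma exists_nat_cutoff (R : realType) (x : R) :
  exists N, forall k, (k < N)%N = (k%:R <= x).
Proof.
have [x0|x0] := leP 0 x.
  by exists (Num.truncn x).+1 => k; rewrite ltnS truncn_ge_nat.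
exists 0%N => k; rewrite ltn0; apply/esym/negbTE; rewrite -ltNge.
exact: lt_le_trans x0 (ler0n _ _).
Qed.

Theorem theorem2p3 (R : realType)
    (d : nat -> measure_display) (Omega : forall n : nat, measurableType (d n))
    (P : forall n : nat, probability (Omega n) R)
    (T1 T2 : forall n : nat, {RV (P n) >-> edge_set 'I_n})
    (T1_unif : forall n : nat, (2 <= n)%N ->
       uniform_on (spanning_trees (complete_graph 'I_n)) (T1 n))
    (T2_unif : forall n : nat, (2 <= n)%N ->
       uniform_on (spanning_trees (complete_graph 'I_n)) (T2 n))
    (T12_indep : forall n : nat, (2 <= n)%N -> independent_RV (T1 n) (T2 n)) :
  let X n : {RV (P n) >-> R} := common_edges (T1 n) (T2 n) in
  cvg_in_distribution X (poisson_RV 2) /\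
  forall m : nat,
    P n [set w | X n w = m%:R] @[n --> \oo] -->
      (2 ^+ m / (expR 1 ^+ 2 * m`!%:R))%:E.
Proof.
move=> X.
have cvgX m : P n [set w | X n w = m%:R] @[n --> \oo] -->
    (2 ^+ m / (expR 1 ^+ 2 * m`!%:R))%:E.
  (* The trees are uniform and independent for n at least 2, so the probability equals
     [overlap_prob] eventually. *)
  apply: (@cvg_trans _ ((overlap_prob 'I_n R m)%:E @[n --> \oo])); last first.
    apply: cvg_EFin; [exact: nearW|exact: cvg_overlap_prob].
  apply: near_eq_cvg; near=> n.
  have n2 : (2 <= n)%N by near: n; exact: nbhs_infty_ge.
  rewrite prob_common_edges ?card_ord //; first exact: leq_trans n2.
  - exact: T1_unif.
  - exact: T2_unif.
  - exact: T12_indep.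
split=> // x _.
(* Both variables take natural values, so at [x] each distribution function is a sum over the same
   [N] point events, and their limits add up. *)
have [N Nx] := exists_nat_cutoff R x.
have -> : (fun n => cdf (X n) x) =
    (fun n => \sum_(k < N) P n [set w | X n w = k%:R])%E.
  apply/funext => n.
  exact: (@cdf_natE _ _ _ _ _ (fun w => #|(T1 n w :&: T2 n w)%SET|)).
rewrite (@cdf_natE _ _ _ _ (poisson_RV (2 : R)) id x N) //.
under eq_bigr => k _ do rewrite poisson_prob_natRV.
apply: (@cvg_sum_fin _ N (fun k n => P n [set w | X n w = k%:R])
  (fun k => 2 ^+ k / (expR 1 ^+ 2 * k`!%:R))).
exact: cvgX.
Unshelve. all: by end_near.
Qed.
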